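(* Let $G = G_1 \times G_2$ and $G' = G_1' \times G_2'$ be two groups of order $2^{2n}$. Let $D_1, D_2, D_1', D_2'$ be difference sets with the symmetric difference property in $G_1, G_2, G_1', G_2'$ respectively, and suppose that \[D = \big(D_1 \times (G_2 - D_2)\big) \cup \big((G_1 - D_1) \times D_2\big), \qquad D' = \big(D_1' \times (G_2' - D_2')\big) \cup \big((G_1' - D_1') \times D_2'\big)\] are difference sets with the symmetric difference property in $G$ and $G'$ respectively. If the development of $D_1$ is isomorphic to the development of $D_1'$ and the development of $D_2$ is isomorphic to the development of $D_2'$, then the development of $D$ is isomorphic to the development of $D'$.
   Context: A $(v,k,\lambda)$ difference set in a group $G$ of order $v$ is a subset $D$ of size $k$ such that the multiset $\{d_1 d_2^{-1} : d_1,d_2 \in D\}$ contains every non-identity element of $G$ exactly $\lambda$ times. Its development is the symmetric design with points the elements of $G$, blocks the left translates $gD$ ($g\in G$), incidence by membership. A symmetric design has the symmetric difference property (SDP) if the symmetric difference of any three blocks is a block or the complement of a block; a difference set has the SDP if its development does. Two symmetric designs are isomorphic if there is a bijection between their point sets preserving incidence, equivalently their incidence matrices satisfy $A_1 = P A_2 Q$ for some permutation matrices $P, Q$. *)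

(* Defs.v *)
From HB Require Import structures.
From mathcomp Require Import all_boot all_fingroup.

Set Implicit Arguments.
Unset Strict Implicit.
Unset Printing Implicit Defensive.

Local Open Scope group_scope.

Section SetSystems.

Variable T : finType.

Definition symdiff (A B : {set T}) : {set T} := (A :\: B) :|: (B :\: A).

(* A design on the point set T is given by its set of blocks, a block being
   the set of points incident with it. *)
Definition symmetric_difference_property (blocks : {set {set T}}) : Prop :=
  forall A B C : {set T}, A \in blocks -> B \in blocks -> C \in blocks ->
    let S := symdiff (symdiff A B) C in (S \in blocks) \/ (~: S \in blocks).

End SetSystems.

Definition design_isomorphic (T T' : finType)
    (blocks : {set {set T}}) (blocks' : {set {set T'}}) : Prop :=
  exists2 f : T -> T', bijective f & [set f @: (B : {set T}) | B in blocks] = blocks'.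

Section DifferenceSets.

Variable gT : finGroupType.

Definition vkl_difference_set (v k lambda : nat) (D : {set gT}) : Prop :=
  [/\ #|[set: gT]| = v, #|D| = k &
      forall g : gT, g != 1 ->
        #|[set d in setX D D | d.1 * d.2^-1 == g]| = lambda].

Definition difference_set (D : {set gT}) : Prop :=
  exists v k lambda : nat, vkl_difference_set v k lambda D.

Definition development (D : {set gT}) : {set {set gT}} := lcosets D [set: gT].

Definition sdp_difference_set (D : {set gT}) : Prop :=
  difference_set D /\ symmetric_difference_property (development D).

End DifferenceSets.

Definition product_set (gT1 gT2 : finGroupType)
    (D1 : {set gT1}) (D2 : {set gT2}) : {set gT1 * gT2} :=
  setX D1 (~: D2) :|: setX (~: D1) D2.

(* Main.v *)
Require Import Defs.
From mathcomp Require Import all_boot all_fingroup.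

(** A left translate of [product_set D1 D2] by [(g1, g2)] is the product set of
    the translates [g1 D1] and [g2 D2], so the development of the product
    consists of the product sets of pairs of blocks. Bijections of the factors
    commute with complements, hence the product of two isomorphisms of the
    factors is an isomorphism of the products. *)

(** The two parts of the union are the two cases of an exclusive or; in this form complements need
    no separate treatment below. *)
Lemma in_product_set (gT1 gT2 : finGroupType) (A : {set gT1}) (B : {set gT2})
    (p : gT1 * gT2) :
  (p \in product_set A B) = (p.1 \in A) (+) (p.2 \in B).
Proof. by rewrite !inE; do 2 case: (_ \in _). Qed.

(** Translating tests [g^-1 * p], which is computed componentwise in the product group. *)
Lemma lcoset_product_set (gT1 gT2 : finGroupType) (A : {set gT1})
    (B : {set gT2}) (g : gT1 * gT2) :
  lcoset (product_set A B) g = product_set (lcoset A g.1) (lcoset B g.2).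
Proof.
by apply/setP => p; rewrite !lcosetE in_product_set !mem_lcoset in_product_set.
Qed.

Lemma development_product_set (gT1 gT2 : finGroupType) (D1 : {set gT1})
    (D2 : {set gT2}) :
  development (product_set D1 D2) =
  [set product_set A B | A in development D1, B in development D2].
Proof.
apply/setP => S; apply/imsetP/imset2P => [[g _ ->] | [A B]].
  by exists (lcoset D1 g.1) (lcoset D2 g.2);
    rewrite ?imset_f ?inE ?lcoset_product_set.
case/imsetP=> g1 _ -> /imsetP[g2 _ ->] ->.
by exists (g1, g2); rewrite ?inE ?lcoset_product_set.
Qed.

Definition pair_map {T1 T2 T1' T2' : Type} (f1 : T1 -> T1') (f2 : T2 -> T2')
  (p : T1 * T2) : T1' * T2' := (f1 p.1, f2 p.2).

Lemma pair_map_bij {T1 T2 T1' T2' : Type} {f1 : T1 -> T1'} {f2 : T2 -> T2'} :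
  bijective f1 -> bijective f2 -> bijective (pair_map f1 f2).
Proof.
case=> h1 f1K h1K [h2 f2K h2K].
by exists (pair_map h1 h2) => -[x y]; rewrite /pair_map /= ?f1K ?f2K ?h1K ?h2K.
Qed.

Lemma imset_product_set (gT1 gT2 gT1' gT2' : finGroupType) (f1 : gT1 -> gT1')
    (f2 : gT2 -> gT2') (A : {set gT1}) (B : {set gT2}) :
  bijective f1 -> bijective f2 ->
  pair_map f1 f2 @: product_set A B = product_set (f1 @: A) (f2 @: B).
Proof.
move=> bij1 bij2; have bij := pair_map_bij bij1 bij2.
(* Surjectivity writes [q] as the image of [h q]; injectivity then lets [mem_imset] cancel the maps
   on both sides. *)
apply/setP => q; have [h _ hK] := bij; rewrite -(hK q).
rewrite (mem_imset _ _ (bij_inj bij)) !in_product_set /=.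
by rewrite (mem_imset _ _ (bij_inj bij1)) (mem_imset _ _ (bij_inj bij2)).
Qed.

Theorem theorem5p1 (n : nat) (G1 G2 G1' G2' : finGroupType)
    (cardG : #|[set: G1 * G2]| = 2 ^ (2 * n))
    (cardG' : #|[set: G1' * G2']| = 2 ^ (2 * n))
    (D1 : {set G1}) (D2 : {set G2}) (D1' : {set G1'}) (D2' : {set G2'})
    (sdpD1 : sdp_difference_set D1) (sdpD2 : sdp_difference_set D2)
    (sdpD1' : sdp_difference_set D1') (sdpD2' : sdp_difference_set D2')
    (sdpD : sdp_difference_set (product_set D1 D2))
    (sdpD' : sdp_difference_set (product_set D1' D2'))
    (iso1 : design_isomorphic (development D1) (development D1'))
    (iso2 : design_isomorphic (development D2) (development D2')) :
  design_isomorphic (development (product_set D1 D2))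
                    (development (product_set D1' D2')).
Proof.
case: iso1 iso2 => [f1 bij1 dev1] [f2 bij2 dev2].
exists (pair_map f1 f2); first exact: pair_map_bij.
(* Both sides now range over pairs of blocks [A], [B] of the developments of [D1] and [D2]: images
   of product sets on the left, product sets of images on the right. *)
rewrite !development_product_set -dev1 -dev2.
apply/setP => S; apply/imsetP/imset2P => [[_ /imset2P[A B devA devB ->] ->] | ].
  by exists (f1 @: A) (f2 @: B); rewrite ?imset_f ?imset_product_set.
case=> _ _ /imsetP[A devA ->] /imsetP[B devB ->] ->.
by exists (product_set A B); rewrite ?imset2_f ?imset_product_set.
Qed.
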